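(* Every game satisfies $$L=150K-S-\sum_{i=1}^{K}\delta_i,\qquad \delta_i\in\mathbb{Z}_{\ge0},$$ where $\delta_i$ is the shortfall of the length of segment $i$ from $150$ when its endpoints have the same colour, and from $149$ when they have different colours. In particular, $L\le 150K-S$.
   Context: Game. Legal moves are those of standard chess (including the initial two-rank pawn advance, en passant, compulsory promotion, and castling, which counts as one move). One ply is one move by one player; White plays the odd-numbered plies. A game is a sequence of legal moves from the standard initial position, continued until the first mandatory termination condition of the FIDE Laws effective from 1 January 2023 applies; $L$ is its number of plies. The mandatory conditions are: (1) checkmate, stalemate, or a dead position (one from which neither player can checkmate by any possible sequence of legal moves); (2) fivefold repetition: the same position (same player to move, same kinds and colours of pieces on the same squares, same possible moves of all pieces of both players, so en passant availability and castling rights matter) has appeared at least five times; (3) the seventy-five-move rule: 150 consecutive plies without a pawn move or a capture (if the final ply delivers checkmate, checkmate takes precedence). Time forfeiture, resignation, draws by agreement and claimable draws are disregarded. Segments. A critical move is a pawn move (a move of a piece while it is still a pawn, including promotion moves) or a capture; every other move (including castling) is noncritical. Let $t_1<\dots<t_m$ be the plies on which critical moves occur. Set $T=1$ if at least one noncritical ply follows the last critical move, or if the game contains no critical move, and $T=0$ otherwise. Put $e_0=0$, $e_i=t_i$ for $1\le i\le m$ and, when $T=1$, $e_{m+1}=L$. The number of segments is $K=m+T$, segment $i$ being the set of plies $\{e_{i-1}+1,\dots,e_i\}$ ($1\le i\le K$), with endpoints $e_{i-1}$ and $e_i$ and length $e_i-e_{i-1}$. Switch count. For $i\ge1$, $\operatorname{col}(e_i)$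 is the colour of the player who moves on ply $e_i$ (White if $e_i$ is odd, Black if even); the virtual endpoint $e_0=0$ is assigned the colour Black. The switch count is $S=\#\{i\in\{1,\dots,K\}:\operatorname{col}(e_i)\ne\operatorname{col}(e_{i-1})\}$. *)

(* Defs.v *)
From HB Require Import structures.
From mathcomp Require Import all_boot all_order all_algebra.

Set Implicit Arguments.
Unset Strict Implicit.
Unset Printing Implicit Defensive.

Inductive color := White | Black.
Inductive side := Kingside | Queenside.
Inductive kind := Pawn | Knight | Bishop | Rook | Queen | King.

Definition bool_of_color c := if c is White then true else false.
Definition color_of_bool (b : bool) := if b then White else Black.
Lemma bool_of_colorK : cancel bool_of_color color_of_bool.
Proof. by case. Qed.
HB.instance Definition _ := Finite.copy color (can_type bool_of_colorK).

Definition bool_of_side d := if d is Kingside then true else false.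
Definition side_of_bool (b : bool) := if b then Kingside else Queenside.
Lemma bool_of_sideK : cancel bool_of_side side_of_bool.
Proof. by case. Qed.
HB.instance Definition _ := Finite.copy side (can_type bool_of_sideK).

Definition ord_of_kind k : 'I_6 :=
  inord match k with
        | Pawn => 0 | Knight => 1 | Bishop => 2
        | Rook => 3 | Queen => 4 | King => 5
        end.
Definition kind_of_ord (i : 'I_6) :=
  nth Pawn [:: Pawn; Knight; Bishop; Rook; Queen; King] i.
Lemma ord_of_kindK : cancel ord_of_kind kind_of_ord.
Proof. by case; rewrite /kind_of_ord inordK. Qed.
HB.instance Definition _ := Finite.copy kind (can_type ord_of_kindK).

Definition opp c := if c is White then Black else White.

(** A square is a pair (file, rank); file a and rank 1 are numbered 0. *)
Definition square := ('I_8 * 'I_8)%type.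
Definition board_t := {ffun square -> option (color * kind)}.

(** [Step s t pr] moves a piece from [s] to [t]; [pr] is the kind chosen when
    the move is a promotion. En passant captures are [Step]s. *)
Inductive move :=
  | Castle of side
  | Step of square & square & option kind.

Definition sum_of_move m : side + square * square * option kind :=
  match m with Castle d => inl d | Step s t pr => inr (s, t, pr) end.
Definition move_of_sum (x : side + square * square * option kind) :=
  match x with inl d => Castle d | inr (s, t, pr) => Step s t pr end.
Lemma sum_of_moveK : cancel sum_of_move move_of_sum.
Proof. by case. Qed.
HB.instance Definition _ := Finite.copy move (can_type sum_of_moveK).

(** [rights] holds the pairs (c, d) such that neither the king of [c] nor its
    original rook on side [d] has moved (or been captured).
    [ep] is the square of the pawn that was advanced two ranks by the
    immediately preceding ply, if any (not the square it passed over). *)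
Record position := Position {
  board : board_t;
  turn : color;
  rights : {set color * side};
  ep : option square
}.

Definition home_rank c : 'I_8 := if c is White then ord0 else ord_max.
Definition last_rank c := home_rank (opp c).
Definition pawn_rank c : 'I_8 := if c is White then inord 1 else inord 6.

Definition king_home c : square := (inord 4, home_rank c).
Definition rook_home c d : square :=
  (if d is Kingside then inord 7 else inord 0, home_rank c).
Definition king_dest c d : square :=
  (if d is Kingside then inord 6 else inord 2, home_rank c).
Definition rook_dest c d : square :=
  (if d is Kingside then inord 5 else inord 3, home_rank c).

Definition back_rank : seq kind :=
  [:: Rook; Knight; Bishop; Queen; King; Bishop; Knight; Rook].

Definition initial_board : board_t :=
  [ffun s : square =>
     if s.2 == home_rank White then Some (White, nth King back_rank s.1)
     else if s.2 == pawn_rank White then Some (White, Pawn)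
     else if s.2 == pawn_rank Black then Some (Black, Pawn)
     else if s.2 == home_rank Black then Some (Black, nth King back_rank s.1)
     else None].

Definition initial : position := Position initial_board White setT None.

(** Absolute difference, subtraction being truncated. *)
Definition gap (m n : nat) := (m - n) + (n - m).
Definition df (s t : square) := gap s.1 t.1.
Definition dr (s t : square) := gap s.2 t.2.

(** [u] is a square other than [s] and [t] whose centre lies on the line
    segment joining those of [s] and [t]. *)
Definition between (s t u : square) :=
  [&& u != s, u != t, df s u + df u t == df s t, dr s u + dr u t == dr s t
    & df s u * dr s t == dr s u * df s t].

Definition clear (b : board_t) (s t : square) :=
  [forall u, between s t u ==> (b u == None)].

(** [t] is exactly [n] ranks ahead of [s], from the viewpoint of [c]. *)
Definition ahead c n (s t : square) : bool :=
  if c is White then t.2 == s.2 + n :> nat else s.2 == t.2 + n :> nat.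

Definition diagonal b s t := [&& s != t, df s t == dr s t & clear b s t].
Definition straight b s t :=
  [&& s != t, (df s t == 0) || (dr s t == 0) & clear b s t].

Definition attacks (b : board_t) (s t : square) : bool :=
  match b s with
  | None => false
  | Some (c, Pawn) => ahead c 1 s t && (df s t == 1)
  | Some (_, Knight) => df s t * dr s t == 2
  | Some (_, Bishop) => diagonal b s t
  | Some (_, Rook) => straight b s t
  | Some (_, Queen) => diagonal b s t || straight b s t
  | Some (_, King) => maxn (df s t) (dr s t) == 1
  end.

Definition attacked (b : board_t) c (t : square) :=
  [exists s, (omap fst (b s) == Some c) && attacks b s t].

Definition in_check (b : board_t) c :=
  [exists t, (b t == Some (c, King)) && attacked b (opp c) t].

(** Moves are described for an arbitrary colour [c], not only for the player
    to move: the repetition rule refers to the possible moves of both players.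
    Only the player to move can capture en passant. *)

Definition en_passant p c (s t : square) :=
  [&& c == turn p, ep p == Some (t.1, s.2), board p s == Some (c, Pawn),
      ahead c 1 s t & df s t == 1].

Definition pawn_step p c (s t : square) :=
  [|| [&& df s t == 0, ahead c 1 s t & board p t == None],
      [&& df s t == 0, s.2 == pawn_rank c, ahead c 2 s t, clear (board p) s t
        & board p t == None],
      [&& df s t == 1, ahead c 1 s t & board p t != None]
    | en_passant p c s t].

Definition promotion_ok c k (t : square) (pr : option kind) :=
  if (k == Pawn) && (t.2 == last_rank c)
  then pr \in [:: Some Queen; Some Rook; Some Bishop; Some Knight]
  else pr == None.

Definition can_castle p c d :=
  [&& (c, d) \in rights p,
      board p (king_home c) == Some (c, King),
      board p (rook_home c d) == Some (c, Rook),
      clear (board p) (king_home c) (rook_home c d)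
    & [forall u, [|| u == king_home c, u == king_dest c d
                   | between (king_home c) (king_dest c d) u]
                 ==> ~~ attacked (board p) (opp c) u]].

(** Legality up to the requirement that the king is not left in check. *)
Definition pseudo_legal p c m : bool :=
  match m with
  | Castle d => can_castle p c d
  | Step s t pr =>
      if board p s is Some (c', k) then
        [&& c' == c,
            (if board p t is Some (c'', k') then (c'' != c) && (k' != King)
             else true),
            (if k == Pawn then pawn_step p c s t else attacks (board p) s t)
          & promotion_ok c k t pr]
      else false
  end.

Definition board_after p c m : board_t :=
  match m with
  | Castle d =>
      [ffun u =>
         if u == king_dest c d then Some (c, King)
         else if u == rook_dest c d then Some (c, Rook)
         else if (u == king_home c) || (u == rook_home c d) then None
         else board p u]
  | Step s t pr =>
      [ffun u =>
         if u == t then omap (fun x => (x.1, odflt x.2 pr)) (board p s)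
         else if u == s then None
         else if en_passant p c s t && (u == (t.1, s.2)) then None
         else board p u]
  end.

Definition legal_for p c m :=
  pseudo_legal p c m && ~~ in_check (board_after p c m) c.

Definition legal p m := legal_for p (turn p) m.

(** It need not be checked which piece stands on a home square: while a right
    is held, the king and rook concerned have not moved. *)
Definition rights_after p m : {set color * side} :=
  match m with
  | Castle _ => [set x in rights p | x.1 != turn p]
  | Step s t _ =>
      [set x in rights p | [&& s != king_home x.1, s != rook_home x.1 x.2
                             & t != rook_home x.1 x.2]]
  end.

Definition ep_after p m : option square :=
  if m is Step s t _ then
    if (board p s == Some (turn p, Pawn)) && (dr s t == 2) then Some t else None
  else None.

Definition play p m : position :=
  Position (board_after p (turn p) m) (opp (turn p))
           (rights_after p m) (ep_after p m).

Fixpoint legal_seq p ms : bool :=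
  if ms is m :: ms' then legal p m && legal_seq (play p m) ms' else true.

Definition checkmate p :=
  in_check (board p) (turn p) && [forall m, ~~ legal p m].

Definition stalemate p :=
  ~~ in_check (board p) (turn p) && [forall m, ~~ legal p m].

Definition dead p : Prop :=
  ~ exists ms, legal_seq p ms /\ checkmate (foldl play p ms).

Definition same_position p q : bool :=
  [&& turn p == turn q, board p == board q, rights p == rights q
    & [forall c, forall m, legal_for p c m == legal_for q c m]].

Definition history (ms : seq move) : seq position :=
  initial :: scanl play initial ms.

Definition fivefold ms :=
  has (fun p => 5 <= count (same_position p) (history ms)) (history ms).

(** En passant captures need no separate case, being pawn moves. *)
Definition critical p m : bool :=
  if m is Step s t _
  then (omap snd (board p s) == Some Pawn) || (board p t != None)
  else false.

Fixpoint critical_flags p ms : seq bool :=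
  if ms is m :: ms' then critical p m :: critical_flags (play p m) ms' else [::].

Definition seventy_five ms :=
  infix (nseq 150 false) (critical_flags initial ms).

Definition terminated ms : Prop :=
  let p := foldl play initial ms in
  [\/ checkmate p \/ stalemate p \/ dead p, fivefold ms | seventy_five ms].

Definition game ms : Prop :=
  [/\ legal_seq initial ms, terminated ms
    & forall n, n < size ms -> ~ terminated (take n ms)].

(** Plies are numbered from 1. *)
Definition critical_plies ms : seq nat :=
  [seq t <- iota 1 (size ms) | nth false (critical_flags initial ms) t.-1].

Definition has_tail ms : bool :=
  (critical_plies ms == [::]) || (last 0 (critical_plies ms) < size ms).

Definition num_segments ms : nat := size (critical_plies ms) + has_tail ms.

Definition endpoint ms (i : nat) : nat :=
  nth 0 (0 :: critical_plies ms ++ (if has_tail ms then [:: size ms] else [::])) i.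

(** The virtual endpoint 0 is Black: [col 0 = Black]. *)
Definition col (n : nat) : color := if odd n then White else Black.

Definition switches ms (i : nat) : bool :=
  col (endpoint ms i) != col (endpoint ms i.-1).

Definition switch_count ms : nat :=
  \sum_(1 <= i < (num_segments ms).+1) switches ms i.

Local Open Scope ring_scope.

Definition segment_length ms (i : nat) : int :=
  (endpoint ms i)%:Z - (endpoint ms i.-1)%:Z.

Definition shortfall ms (i : nat) : int :=
  (if switches ms i then 149 else 150) - segment_length ms i.

(* Main.v *)
Require Import Defs.
From HB Require Import structures.
From mathcomp Require Import all_boot all_order all_algebra.
From mathcomp Require Import zify.

(** The mover alternates, so the colours of the two endpoints of a segment
    encode the parity of its length: endpoints of different colours force an odd
    length, which turns the bound 150 into 149.  The bound 150 itself
    ([segment_length_le150]) comes from the seventy-five-move rule: the plies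
    strictly inside a segment are noncritical, so in a segment of more than 150
    plies the first 150 would already form a noncritical run ending before the
    last ply of the segment, hence before the end of the game, and the game
    would have stopped there.  A segment that closes with a critical ply and
    the final noncritical one are treated alike, since only the plies strictly
    between two endpoints matter.  The formula for the number of plies then
    follows because the segment lengths telescope to the last endpoint, which is
    the last ply ([endpoint_last]). *)

Set Implicit Arguments.
Unset Strict Implicit.
Unset Printing Implicit Defensive.

Import Order.TTheory GRing.Theory Num.Theory.

Lemma size_critical_flags p ms : size (critical_flags p ms) = size ms.
Proof. by elim: ms p => //= m ms IHms p; rewrite IHms. Qed.

Lemma critical_flags_take p n ms :
  critical_flags p (take n ms) = take n (critical_flags p ms).
Proof. by elim: ms n p => [|m ms IHms] [|n] p //=; rewrite IHms. Qed.

Lemma infix_nseq_take (T : eqType) (x0 x : T) (s : seq T) a k :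
  a + k <= size s -> (forall i, i < k -> nth x0 s (a + i) = x) ->
  infix (nseq k x) (take (a + k) s).
Proof.
move=> le_s eq_x.
have -> : nseq k x = drop a (take (a + k) s).
  apply: (@eq_from_nth _ x0).
    by rewrite size_nseq size_drop size_takel // addKn.
  move=> i; rewrite size_nseq => lt_ik.
  by rewrite nth_nseq lt_ik nth_drop nth_take ?ltn_add2l // eq_x.
exact: infix_drop.
Qed.

(** The list inside [endpoint], named so that sortedness and membership can be
    stated for all endpoints at once. *)
Definition endpoints ms : seq nat :=
  0 :: critical_plies ms ++ (if has_tail ms then [:: size ms] else [::]).

Lemma size_endpoints ms : size (endpoints ms) = (num_segments ms).+1.
Proof. by rewrite /= size_cat /num_segments; case: has_tail. Qed.

Lemma mem_critical_plies ms t :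
  (t \in critical_plies ms) =
  (0 < t <= size ms) && nth false (critical_flags initial ms) t.-1.
Proof. by rewrite mem_filter mem_iota add1n ltnS andbC. Qed.

Lemma last_critical_plies_le ms : last 0 (critical_plies ms) <= size ms.
Proof.
have := mem_last 0 (critical_plies ms).
by rewrite inE mem_critical_plies => /predU1P[-> //|/andP[/andP[]]].
Qed.

Lemma endpoints_sorted ms : sorted leq (endpoints ms).
Proof.
have cp_path : path leq 0 (critical_plies ms).
  rewrite path_min_sorted; last by apply/allP.
  by apply: sorted_filter (iota_sorted _ _); exact: leq_trans.
rewrite /endpoints /= cat_path cp_path /=.
by case: has_tail; rewrite //= last_critical_plies_le.
Qed.

Lemma endpoint_last ms : endpoint ms (num_segments ms) = size ms.
Proof.
have -> : num_segments ms = (size (endpoints ms)).-1 by rewrite size_endpoints.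
rewrite /endpoint -/(endpoints ms) nth_last /= last_cat.
case tailE: has_tail => //=; apply/eqP.
rewrite eqn_leq last_critical_plies_le leqNgt.
by move: tailE; rewrite /has_tail => /norP[].
Qed.

Lemma endpoint_homo ms i j :
  i <= j <= num_segments ms -> endpoint ms i <= endpoint ms j.
Proof.
move=> /andP[le_ij le_jK].
apply: (sorted_leq_nth leq_trans leqnn 0 (endpoints_sorted ms)) => //.
  by rewrite inE size_endpoints ltnS (leq_trans le_ij).
by rewrite inE size_endpoints ltnS.
Qed.

(** Every critical ply is an endpoint, and the endpoints are sorted, so none
    lies strictly between two consecutive ones. *)
Lemma noncritical_inside_segment ms i j :
  i < num_segments ms -> endpoint ms i < j < endpoint ms i.+1 ->
  nth false (critical_flags initial ms) j.-1 = false.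
Proof.
move=> lt_iK /andP[lt_j lt_j']; apply/negbTE/negP=> crit_j.
have le_j : j <= size ms.
  by rewrite -endpoint_last (leq_trans (ltnW lt_j')) ?endpoint_homo ?lt_iK /=.
have j_end : j \in endpoints ms.
  by rewrite inE mem_cat mem_critical_plies le_j crit_j (leq_ltn_trans _ lt_j)
             ?orbT.
have le_k : index j (endpoints ms) <= num_segments ms.
  by rewrite -ltnS -size_endpoints index_mem.
have endpoint_index : endpoint ms (index j (endpoints ms)) = j.
  exact: nth_index.
case: (leqP (index j (endpoints ms)) i) => [le_ki | lt_ik].
  have : j <= endpoint ms i.
    by rewrite -{1}endpoint_index endpoint_homo ?le_ki ?(ltnW lt_iK).
  by rewrite leqNgt lt_j.
have : endpoint ms i.+1 <= j.
  by rewrite -{1}endpoint_index endpoint_homo ?lt_ik.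
by rewrite leqNgt lt_j'.
Qed.

(** A longer segment starts with 150 noncritical plies none of which is its last
    ply, so the prefix of the game ending with them is proper and already
    terminated by the seventy-five-move rule. *)
Lemma segment_length_le150 g i : game g -> i < num_segments g ->
  endpoint g i.+1 <= endpoint g i + 150.
Proof.
move=> [_ _ running] lt_iK; rewrite leqNgt; apply/negP=> too_long.
have lt_size : endpoint g i + 150 < size g.
  by rewrite (leq_trans too_long) // -endpoint_last endpoint_homo ?lt_iK /=.
apply: (running _ lt_size); apply: Or33.
rewrite /seventy_five critical_flags_take.
apply: (@infix_nseq_take _ false).
  by rewrite size_critical_flags ltnW.
move=> k lt_k.
apply: (noncritical_inside_segment (j := (endpoint g i + k).+1) lt_iK).
by rewrite ltnS leq_addr /= (leq_ltn_trans _ too_long) // ltn_add2l.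
Qed.

Lemma col_neq m n : (Defs.col m != Defs.col n) = (odd m != odd n).
Proof. by rewrite /Defs.col; case: (odd m); case: (odd n). Qed.

Local Open Scope ring_scope.

Lemma shortfall_ge0 g i : game g -> (i < num_segments g)%N ->
  0 <= shortfall g i.+1.
Proof.
move=> Hg lt_iK; have le150 := segment_length_le150 Hg lt_iK.
rewrite /shortfall /segment_length /switches col_neq /=.
case: ifP => [neq_odd|_]; last by lia.
(* A length of exactly 150 would give both endpoints the same parity. *)
suff : endpoint g i.+1 <> (endpoint g i + 150)%N by lia.
by move=> eq150; move: neq_odd; rewrite eq150 oddD addbF eqxx.
Qed.

Lemma sum_segment_length g :
  \sum_(1 <= i < (num_segments g).+1) segment_length g i = (size g)%:Z.
Proof.
rewrite big_add1 /= (telescope_sumr (fun i => (endpoint g i)%:Z)) //.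
by rewrite endpoint_last subr0.
Qed.

Lemma sum_shortfall g :
  \sum_(1 <= i < (num_segments g).+1) shortfall g i =
  150 * (num_segments g)%:Z - (switch_count g)%:Z - (size g)%:Z.
Proof.
have shortfallE i :
    shortfall g i = 150 - (switches g i : nat)%:Z - segment_length g i.
  by rewrite /shortfall; case: switches; lia.
under eq_bigr => i _ do rewrite shortfallE.
rewrite 2!sumrB sum_segment_length sumr_const_nat subSS subn0.
rewrite -(mulr_natr 150) (natz (num_segments g)).
by rewrite /switch_count (big_morph Posz PoszD (erefl 0%:Z)).
Qed.

Theorem lemma2p4 (g : seq move) (Hg : game g) :
  [/\ forall i : nat, (1 <= i <= num_segments g)%N -> 0 <= shortfall g i,
      (size g)%:Z = 150 * (num_segments g)%:Z - (switch_count g)%:Z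
                    - \sum_(1 <= i < (num_segments g).+1) shortfall g i
    & (size g)%:Z <= 150 * (num_segments g)%:Z - (switch_count g)%:Z].
Proof.
have short_ge0 i : (1 <= i <= num_segments g)%N -> 0 <= shortfall g i.
  by case: i => // i; apply: shortfall_ge0.
have sum_ge0 : 0 <= \sum_(1 <= i < (num_segments g).+1) shortfall g i.
  by rewrite big_nat; apply: sumr_ge0 => i; apply: short_ge0.
by split=> //; move: sum_ge0; rewrite sum_shortfall; lia.
Qed.
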